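(* Let $X$ be a spherical $G$-variety with $\Gamma(X,\mathcal{O}_X^* )=\mathbb{K}^*$ and $\overline{X}=\operatorname{Spec}\mathcal{R}(X)$, regarded as a spherical $\overline{G}$-variety. For every $D\in\Delta$ one has $\pi_*(e_D^* )=\rho(D)$.
   Context: Work over an algebraically closed field $\mathbb{K}$ of characteristic zero. Let $G$ be a connected reductive group with Borel subgroup $B$ and maximal torus $T\subseteq B$. A spherical $G$-variety is a normal irreducible $G$-variety $X$ with a dense $B$-orbit. Let $\mathcal{M}$ be the lattice of weights of $B$-semi-invariant rational functions on $X$, $\mathcal{N}=\operatorname{Hom}(\mathcal{M},\mathbb{Z})$; for $\chi\in\mathcal{M}$ let $f_\chi\in\mathbb{K}(X)$ be $B$-semi-invariant of weight $\chi$. Let $\Delta$ be the finite set of $B$-invariant prime divisors in $X$, with $\rho\colon\Delta\to\mathcal{N}$, $\langle\rho(D),\chi\rangle=\nu_D(f_\chi)$. The Cox ring is $\mathcal{R}(X)=\bigoplus_{[D]\in\operatorname{Cl}(X)}\Gamma(X,\mathcal{O}_X(D))$ with the standard multiplication (as in Arzhantsev–Derenthal–Hausen–Laface, ''Cox Rings'': choose a finitely generated group $L$ of Weil divisors on $X$ mapping onto $\operatorname{Cl}(X)$, with kernel $L^0$, and a homomorphism $\theta\colon L^0\to\mathbb{K}(X)^*$ with $\operatorname{div}\theta(E)=E$ for all $E\in L^0$; then $\mathcal{R}(X)$ is the quotient of the $L$-graded algebra $\bigoplus_{D\in L}\Gamma(X,\mathcal{O}_X(D))$, with multiplication taken in $\mathbb{K}(X)$,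 by the ideal generated by all $1-\theta(E)$, $E\in L^0$, where $1$ is placed in degree $0$ and $\theta(E)$ in degree $-E$; its component of degree $[D]$ is identified with $\Gamma(X,\mathcal{O}_X(D))$, and up to isomorphism of graded algebras it does not depend on the choices); it is finitely generated. Let $\mathbb{T}=\operatorname{Spec}\mathbb{K}[\operatorname{Cl}(X)]$ act on $\overline{X}$ via the grading, and let $\widehat{X}\subseteq\overline{X}$ be the open subset with complement of codimension at least $2$ having a good quotient $\pi\colon\widehat{X}\to X$ by $\mathbb{T}$. There exist a connected reductive group $G'$, a finite epimorphism $\varepsilon\colon G'\to G$, and a $G'$-action on $\widehat{X}$ (hence on $\overline{X}$) commuting with $\mathbb{T}$ such that $\pi$ is equivariant for $\overline{G}=G'\times\mathbb{T}^\circ$, acting on $X$ via $\varepsilon\colon\overline{G}\to G$. Fix such data and $\overline{T}\subseteq\overline{B}\subseteq\overline{G}$ (maximal torus, Borel subgroup) mapping onto $T\subseteq B$. Then $\overline{X}$ is a spherical $\overline{G}$-variety; $\overline{\mathcal{M}}$ is the lattice of weights of its $\overline{B}$-semi-invariant rational functions and $\overline{\mathcal{N}}=\operatorname{Hom}(\overline{\mathcal{M}},\mathbb{Z})$. For $D\in\Delta$ the canonical section $1_D\in\Gamma(X,\mathcal{O}_X(D))\subseteq\mathcal{R}(X)$ is $\overline{B}$-semi-invariant; its weight is $e_D\in\overline{\mathcal{M}}$. The $e_D$ form a $\mathbb{Z}$-basis of $\overline{\mathcal{M}}$, and $(e_D^* )_{D\in\Delta}$ is the dual basis of $\overline{\mathcal{N}}$.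 Pullback of $B$-semi-invariant rational functions along $\pi$ gives an injective map $\pi^*\colon\mathcal{M}\to\overline{\mathcal{M}}$, with dual map $\pi_*\colon\overline{\mathcal{N}}\to\mathcal{N}$. *)

(* Defs.v *)
From mathcomp Require Import all_boot all_algebra.
From mathcomp Require Import boolp classical_sets functions cardinality fsbigop.
From mathcomp.multinomials Require mpoly.

Set Implicit Arguments.
Unset Strict Implicit.
Unset Printing Implicit Defensive.

Import GRing.Theory.
Local Open Scope classical_set_scope.
Local Open Scope ring_scope.

(** Varieties over an algebraically closed field are treated classically, as
    spaces with functions: a set of (closed) points, its Zariski topology and its
    sheaf of K-valued regular functions.  A section over U is represented by a
    total function of which only the values on U matter. *)
Record kspace (K : closedFieldType) (T : Type) := KSpace {
  opn : set (set T);
  reg : set T -> set (T -> K) }.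

Section Topology.
Variables (K : closedFieldType) (T : Type) (X : kspace K T).

Definition clsd (Z : set T) := opn X (~` Z).

Definition irreducible (Z : set T) := Z !=set0 /\
  forall C1 C2, clsd C1 -> clsd C2 -> Z `<=` C1 `|` C2 -> Z `<=` C1 \/ Z `<=` C2.

Definition connected (Z : set T) := forall U V, opn X U -> opn X V ->
  Z `<=` U `|` V -> Z `&` U !=set0 -> Z `&` V !=set0 -> Z `&` U `&` V !=set0.

Definition dense (Z : set T) := forall U, opn X U -> U !=set0 -> Z `&` U !=set0.

(* every irreducible component of Z has codimension at least 2 *)
Definition codim_ge2 (Z : set T) := forall Z0, clsd Z0 -> irreducible Z0 ->
  Z0 `<=` Z -> exists Z1 Z2, [/\ clsd Z1, irreducible Z1, clsd Z2, irreducible Z2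
    & Z0 `<` Z1 /\ Z1 `<` Z2].

Definition prime_divisor (D : set T) := [/\ clsd D, irreducible D, D <> setT &
  forall Z, clsd Z -> irreducible Z -> D `<=` Z -> Z = D \/ Z = setT].

Definition space_with_functions :=
  [/\ opn X setT,
      forall U V, opn X U -> opn X V -> opn X (U `&` V) &
      forall F : set (set T), F `<=` opn X -> opn X (\bigcup_(U in F) U)] /\
  [/\ forall U V f, opn X U -> opn X V -> V `<=` U -> reg X U f -> reg X V f,
      forall U f, opn X U ->
        (forall x, U x -> exists V, [/\ opn X V, V x, V `<=` U & reg X V f]) ->
        reg X U f &
      forall U f g, opn X U -> reg X U f -> (forall x, U x -> f x = g x) ->
        reg X U g] /\
  [/\ forall U c, opn X U -> reg X U (cst c),
      forall U f g, opn X U -> reg X U f -> reg X U g ->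
        reg X U (f + g) /\ reg X U (f * g) &
      forall U f, opn X U -> reg X U f -> let V := U `&` [set x | f x != 0] in
        opn X V /\ reg X V (fun x => (f x)^-1)].

(* U is isomorphic, through the coordinates a, to a closed subset of affine
   n-space with its Zariski topology and regular functions *)
Definition affine (U : set T) := opn X U /\
  exists (n : nat) (a : T -> 'I_n -> K),
  [/\ forall x y, U x -> U y -> a x = a y -> x = y,
      exists I : set (mpoly.mpoly n K),
        a @` U = [set v | forall p, I p -> mpoly.meval v p = 0],
      forall V, V `<=` U -> opn X V <-> forall x, V x -> exists q : mpoly.mpoly n K,
        mpoly.meval (a x) q != 0 /\
        forall y, U y -> mpoly.meval (a y) q != 0 -> V y &
      forall V f, V `<=` U -> opn X V ->
        reg X V f <-> forall x, V x -> exists p q : mpoly.mpoly n K,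
        mpoly.meval (a x) q != 0 /\
        forall y, V y -> mpoly.meval (a y) q != 0 ->
          f y = mpoly.meval (a y) p / mpoly.meval (a y) q].

End Topology.

Section Product.
Variables (K : closedFieldType) (S T : Type) (X : kspace K S) (Y : kspace K T).

Definition tensor n (c : 'I_n -> S -> K) (d : 'I_n -> T -> K) (z : S * T) : K :=
  \sum_i c i z.1 * d i z.2.

Definition reg_tensor (U : set S) (V : set T) n (c : 'I_n -> S -> K)
    (d : 'I_n -> T -> K) :=
  [/\ opn X U, opn Y V, forall i, reg X U (c i) & forall i, reg Y V (d i)].

(* The product of varieties: its topology has as basis the nonvanishing loci of
   sums of products of regular functions on open boxes, and its regular functions
   are locally quotients of such sums. *)
Definition prod_space : kspace K (S * T) := KSpace
  [set W | forall z, W z -> exists U V n (c : 'I_n -> S -> K) (d : 'I_n -> T -> K),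
     [/\ reg_tensor U V c d, U z.1, V z.2, tensor c d z != 0 &
         forall w, U w.1 -> V w.2 -> tensor c d w != 0 -> W w]]
  (fun W => [set f | forall z, W z -> exists U V n (c : 'I_n -> S -> K)
       (d : 'I_n -> T -> K) m (a : 'I_m -> S -> K) (b : 'I_m -> T -> K),
     [/\ reg_tensor U V c d, reg_tensor U V a b, U z.1 /\ V z.2,
         tensor c d z != 0 &
         forall w, U w.1 -> V w.2 -> tensor c d w != 0 ->
           W w /\ f w = tensor a b w / tensor c d w]]).

(* phi restricted to the open subset U is a morphism of varieties *)
Definition morphism_on (U : set S) (phi : S -> T) := opn X U /\
  forall V, opn Y V -> opn X (U `&` phi @^-1` V) /\
    forall f, reg Y V f -> reg X (U `&` phi @^-1` V) (f \o phi).

End Product.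

Section Varieties.
Variables (K : closedFieldType) (T : Type) (X : kspace K T).

Definition variety := [/\ space_with_functions X,
  exists n (U : 'I_n -> set T), (forall i, affine X (U i)) /\
    forall x, exists i, U i x &
  clsd (prod_space X X) [set z | z.1 = z.2]].

(** For irreducible X, an element of K(X) is represented by a total function that
    is regular on some nonempty open set, up to [req]. *)
Definition rational (f : T -> K) := exists U, [/\ opn X U, U !=set0 & reg X U f].

Definition req (f g : T -> K) :=
  exists U, [/\ opn X U, U !=set0 & forall x, U x -> f x = g x].

Definition rational_unit (f : T -> K) := rational f /\ ~ req f 0.

(* f lies in the local ring of X along the irreducible closed subset Z *)
Definition in_local_ring (Z : set T) (f : T -> K) := exists U g,
  [/\ opn X U, U `&` Z !=set0, reg X U g & req f g].

Definition normal := forall x f, rational f ->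
  (exists n (a : 'I_n -> T -> K), (forall i, in_local_ring [set x] (a i)) /\
     req (f ^+ n + \sum_(i < n) a i * f ^+ i) 0) ->
  in_local_ring [set x] f.

(* v is nu_D, that is, the normalized discrete valuation of K(X) whose valuation
   ring is the local ring of X along D.  Its value on 0 is irrelevant. *)
Definition divisor_valuation (D : set T) (v : (T -> K) -> int) :=
  [/\ forall f g, rational_unit f -> req f g -> v f = v g,
      forall f g, rational_unit f -> rational_unit g -> v (f * g) = v f + v g,
      forall f, rational_unit f -> (0 <= v f) <-> in_local_ring D f &
      exists f, rational_unit f /\ v f = 1].

End Varieties.

Section AlgebraicGroups.
Variables (K : closedFieldType) (G : groupType) (sG : kspace K G).

Definition alg_group := [/\ variety sG, affine sG setT,
  morphism_on (prod_space sG sG) sG setT (fun z => (z.1 * z.2)%g) &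
  morphism_on sG sG setT (fun x : G => (x^-1)%g)].

Definition is_subgroup (H : set G) :=
  [/\ H 1%g, forall x y, H x -> H y -> H (x * y)%g & forall x, H x -> H (x^-1)%g].

Definition closed_subgroup (H : set G) := is_subgroup H /\ clsd sG H.

Definition derived (H : set G) : set G := [set x | forall S, is_subgroup S ->
  (forall a b, H a -> H b -> S (a^-1 * b^-1 * a * b)%g) -> S x].

Definition solvable (H : set G) := exists n, iter n derived H `<=` [set 1%g].

(* right translation by g is a locally unipotent operator on K[G] *)
Definition unipotent (g : G) := forall f, reg sG setT f -> exists n,
  forall x, iter n (fun h (y : G) => h (y * g)%g - h y) f x = 0.

Definition connected_reductive := [/\ alg_group, connected sG setT &
  forall U, closed_subgroup U -> connected sG U ->
    (forall x y : G, U x -> U (y * x * y^-1)%g) ->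
    (forall x, U x -> unipotent x) -> U `<=` [set 1%g]].

Definition identity_component : set G :=
  [set x | exists C, [/\ connected sG C, C 1%g & C x]].

(* the c i are the coordinates of an isomorphism of algebraic groups from H onto
   the n-th power of the multiplicative group; the regular functions on the closed
   subgroup H are the restrictions of those on the affine variety G *)
Definition is_torus (H : set G) := closed_subgroup H /\
  exists n (c : 'I_n -> G -> K),
  [/\ forall i, reg sG setT (c i),
      forall i x y, H x -> H y -> c i (x * y)%g = c i x * c i y,
      forall i x, H x -> c i x != 0,
      forall t : 'I_n -> K, (forall i, t i != 0) ->
        exists! x, H x /\ forall i, c i x = t i &
      forall f, reg sG setT f -> exists (p : mpoly.mpoly n K) (m : nat),
        forall x, H x ->
          f x = mpoly.meval (fun i => c i x) p / (\prod_i c i x) ^+ m].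

(* below, Q is an algebraic group given as a closed subgroup of G *)
Definition borel (Q B : set G) :=
  let P := [set H | [/\ closed_subgroup H, connected sG H, solvable H & H `<=` Q]] in
  P B /\ forall H, P H -> B `<=` H -> H = B.

Definition maximal_torus (Q S : set G) :=
  let P := [set H | is_torus H /\ H `<=` Q] in
  P S /\ forall H, P H -> S `<=` H -> H = S.

Definition character (H : set G) (chi : H -> K) :=
  [/\ forall a b c : H, val c = (val a * val b)%g -> chi c = chi a * chi b,
      forall a, chi a != 0 &
      exists f, reg sG setT f /\ forall a, chi a = f (val a)].

End AlgebraicGroups.

Definition finite_epimorphism (K : closedFieldType) (G' G : groupType)
    (sG' : kspace K G') (sG : kspace K G) (eps : G' -> G) :=
  [/\ forall x y, eps (x * y)%g = (eps x * eps y)%g,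
      morphism_on sG' sG setT eps,
      forall y, exists x, eps x = y &
      exists n (s : 'I_n -> G' -> K), (forall i, reg sG' setT (s i)) /\
        forall f, reg sG' setT f -> exists c : 'I_n -> G -> K,
          (forall i, reg sG setT (c i)) /\
          forall x, f x = \sum_i c i (eps x) * s i x].

Section Actions.
Variables (K : closedFieldType) (G : groupType) (sG : kspace K G).
Variables (T : Type) (X : kspace K T) (act : G -> T -> T).

Definition alg_action := [/\ forall x, act 1%g x = x,
  forall g h x, act (g * h)%g x = act g (act h x) &
  morphism_on (prod_space sG X) X setT (fun z => act z.1 z.2)].

(* X is spherical for a reductive subgroup of G having B as a Borel subgroup *)
Definition spherical (B : set G) := [/\ variety X, irreducible X setT, normal X,
  alg_action & exists x, dense X [set act b x | b in B]].

(* (b . f)(x) = f (b^-1 . x) *)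
Definition semi_invariant (B : set G) (chi : B -> K) (f : T -> K) :=
  forall b : B, req X (fun x => f (act (val b)^-1%g x)) (fun x => chi b * f x).

Definition weights (B : set G) : set (B -> K) := [set chi | character sG chi /\
  exists f, rational_unit X f /\ semi_invariant chi f].

Definition invariant_primes (B : set G) : set (set T) := [set D |
  prime_divisor X D /\ forall b x, B b -> D x -> D (act b x)].

End Actions.

Arguments weights {K G} sG {T} X act B.

Section Lattices.
Variables (K : closedFieldType) (B : Type) (M : set (B -> K)).

(* Hom(M, Z) for a multiplicative group M of functions *)
Definition dual_lattice : set (M -> int) := [set nu |
  forall a b c : M, val c = val a * val b :> (B -> K) -> nu c = nu a + nu b].

Definition lattice_basis (I : choiceType) (e : I -> M) := forall chi : M,
  exists! c : I -> int, finite_set [set i | c i != 0] /\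
    forall b, val chi b = \big[*%R/1]_(i \in [set: I]) (val (e i) b ^ c i).

Definition dual_basis (I : choiceType) (e : I -> M) (estar : I -> M -> int) :=
  forall i, dual_lattice (estar i) /\ forall j, estar i (e j) = (i == j)%:Z.

End Lattices.

Section CoxRings.
Variables (K : closedFieldType) (T : Type) (X : kspace K T).
(* nu D is the valuation of K(X) along the prime divisor D *)
Variable nu : set T -> (T -> K) -> int.

Definition weil_divisor (E : set T -> int) :=
  finite_set [set D | E D != 0] /\ forall D, E D != 0 -> prime_divisor X D.

Definition div (f : T -> K) : set T -> int :=
  fun D => if `[< prime_divisor X D >] then nu D f else 0.

Definition principal (E : set T -> int) :=
  exists f, rational_unit X f /\ div f = E.

(* sections over U of the sheaf O_X(E) *)
Definition sections (U : set T) (E : set T -> int) : set (T -> K) := [set f |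
  rational X f /\ (~ req X f 0 -> forall D, prime_divisor X D -> D `&` U !=set0 ->
    0 <= nu D f + E D)].

(* L is a finitely generated group of Weil divisors mapping onto Cl(X) *)
Definition divisor_group (L : set (set T -> int)) :=
  [/\ L `<=` weil_divisor,
      exists n (s : 'I_n -> set T -> int),
        L = [set E | exists c : 'I_n -> int, E = \sum_i s i *~ c i] &
      forall E, weil_divisor E -> exists2 F, L F & principal (E - F)].

Variables (L : set (set T -> int)) (theta : (set T -> int) -> T -> K).

Definition principal_splitting :=
  (forall E, L E -> principal E ->
     rational_unit X (theta E) /\ div (theta E) = E) /\
  (forall E F, L E -> principal E -> L F -> principal F ->
     req X (theta (E + F)) (theta E * theta F)).

(* elements of the L-graded algebra of sections of the O_X(E), E in L, over U;
   s E is the component of degree E *)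
Definition graded_sections (U : set T) : set ((set T -> int) -> T -> K) := [set s |
  [/\ finite_set [set E | s E <> 0], forall E, s E <> 0 -> L E &
      forall E, sections U E (s E)]].

(* the ideal generated by the 1 - theta(E), theta(E) being placed in degree -E:
   the degree F component of a * (1 - theta(E)) is a F - a (F + E) * theta E *)
Definition cox_ideal (U : set T) (s : (set T -> int) -> T -> K) :=
  exists n (a : 'I_n -> (set T -> int) -> T -> K) (E : 'I_n -> set T -> int),
  [/\ forall i, graded_sections U (a i), forall i, L (E i) /\ principal (E i) &
      forall F, req X (s F) (\sum_i (a i F - a i (F + E i) * theta (E i)))].

Variables (Tb : Type) (Xb : kspace K Tb).
Variable Phi : (set T -> int) -> (T -> K) -> (Tb -> K).

(* Phi E is the degree E part of a surjective homomorphism of K-algebras, with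
   kernel [cox_ideal U], from the algebra of [graded_sections U] onto O(V): it
   identifies O(V) with the algebra R(U) of sections over U of the Cox sheaf of X *)
Definition cox_presentation (U : set T) (V : set Tb) :=
  [/\ forall E f, L E -> sections U E f -> reg Xb V (Phi E f),
      forall E f g x, L E -> sections U E f -> req X f g -> V x ->
        Phi E f x = Phi E g x &
      forall E f g c x, L E -> sections U E f -> sections U E g -> V x ->
        Phi E (cst c * f + g) x = c * Phi E f x + Phi E g x] /\
  [/\ forall E F f g x, L E -> L F -> sections U E f -> sections U F g -> V x ->
        Phi (E + F) (f * g) x = Phi E f x * Phi F g x &
      forall x, V x -> Phi 0 1 x = 1] /\
  [/\ forall h, reg Xb V h -> exists2 s, graded_sections U s &
        forall x, V x -> h x = \sum_(E \in L) Phi E (s E) x &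
      forall s, graded_sections U s ->
        (forall x, V x -> \sum_(E \in L) Phi E (s E) x = 0) <-> cox_ideal U s].

(* s is the canonical section 1_D, as an element of the Cox ring.  As D need not be
   in L, its class is represented by some E in L, and O_X(D) is identified with
   O_X(E) by multiplication with some h such that div h = D - E; up to
   nonzero constants, the result does not depend on E and h. *)
Definition canonical_section (D : set T) (s : Tb -> K) := exists E h,
  [/\ L E, rational_unit X h, div h = (fun D' => (D' == D)%:Z) - E & s = Phi E h].

(* H = Spec K[Cl(X)]: the ev E are its characters, [E] being the element of
   Cl(X) = L / L^0 *)
Definition cox_torus (H : groupType) (sH : kspace K H)
    (ev : (set T -> int) -> H -> K) :=
  [/\ alg_group sH,
      forall E, L E -> reg sH setT (ev E) /\
        forall s t, ev E (s * t)%g = ev E s * ev E t /\ ev E s != 0,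
      forall E F t, L E -> L F -> ev (E + F) t = ev E t * ev F t,
      forall E, L E -> (forall t, ev E t = 1) <-> principal E &
      forall f, reg sH setT f -> exists n (c : 'I_n -> K) (E : 'I_n -> set T -> int),
        (forall i, L (E i)) /\ forall t, f t = \sum_i c i * ev (E i) t].

(* Xb = Spec R(X) *)
Definition total_coordinate_space :=
  affine Xb setT /\ cox_presentation setT setT.

Variables (H : groupType) (ev : (set T -> int) -> H -> K) (actH : H -> Tb -> Tb).

(* the action of H on Xb defined by the grading of R(X) *)
Definition grading_action := forall E f t x, L E -> sections setT E f ->
  Phi E f (actH t x) = ev E t * Phi E f x.

Variables (Xh : set Tb) (pi : Tb -> T).

(* pi, of which only the restriction to Xh matters, is a good quotient by H *)
Definition good_quotient :=
  [/\ forall t x, Xh x -> Xh (actH t x),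
      morphism_on Xb X Xh pi,
      forall t x, Xh x -> pi (actH t x) = pi x,
      forall U, affine X U -> affine Xb (Xh `&` pi @^-1` U) &
      forall U, opn X U ->
       (forall f g, reg X U f -> reg X U g ->
          (forall x, Xh x -> U (pi x) -> f (pi x) = g (pi x)) ->
          forall y, U y -> f y = g y) /\
       (forall h, reg Xb (Xh `&` pi @^-1` U) h ->
          (forall t x, Xh x -> U (pi x) -> h (actH t x) = h x) ->
          exists2 f, reg X U f & forall x, Xh x -> U (pi x) -> h x = f (pi x))].

(* pi : Xh -> X is the relative spectrum of the Cox sheaf, sitting in Xb as an open
   subset with complement of codimension at least 2 *)
Definition characteristic_space :=
  [/\ opn Xb Xh, codim_ge2 Xb (~` Xh), good_quotient,
      forall U, opn X U -> U !=set0 -> cox_presentation U (Xh `&` pi @^-1` U) &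
      forall U f x, opn X U -> U !=set0 -> reg X U f -> Xh x -> U (pi x) ->
        Phi 0 f x = f (pi x)].

End CoxRings.

(* <rho(D), chi> = nu_D(f_chi) *)
Definition rho (K : closedFieldType) (T : Type) (nu : set T -> (T -> K) -> int)
    (B : Type) (M : set (B -> K)) (f : M -> T -> K) (D : set T) : M -> int :=
  fun chi => nu D (f chi).

(* the map Hom(Mb, Z) -> Hom(M, Z) dual to u : M -> Mb *)
Definition dual_map (M Mb : Type) (u : M -> Mb) (nu : Mb -> int) : M -> int :=
  nu \o u.

(* Main.v *)
Require Import Defs.
From mathcomp Require Import all_boot all_order all_algebra.
From mathcomp Require Import boolp classical_sets functions cardinality fsbigop.
From mathcomp Require Import zify.

Set Implicit Arguments.
Unset Strict Implicit.
Unset Printing Implicit Defensive.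

Import Order.TTheory GRing.Theory Num.Theory.
Local Open Scope classical_set_scope.
Local Open Scope ring_scope.

(** Write n_D for nu_D (f_chi).  Classically div f_chi is the sum of the n_D D
    over the B-invariant primes D, hence the pullback of f_chi to Xb is, up to a
    constant, the product of the 1_D ^ n_D; comparing weights, pi^* chi is the
    combination of the e_D with coefficients n_D, and pairing with e_D^* returns
    n_D.

    The proof below runs this argument backwards, which avoids showing that the
    divisor of f_chi is finite and supported on B-invariant primes.  The basis
    (e_D) supplies finitely many exponents c_D with pi^* chi = prod e_D ^ c_D.
    Splitting c = p - q into natural numbers, the functions
    (f_chi o pi) * prod 1_D ^ q_D and prod 1_D ^ p_D are semi-invariant of the
    same weight; since Xb has a dense orbit of the Borel subgroup, they are
    proportional ([semi_invariant_uniq]).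

    Both are homogeneous elements of the Cox ring over any nonempty open U on
    which f_chi is regular, and a homogeneous element determines its divisor
    ([section_divisor_uniq]).  This is where the structure of the Cox ring
    enters: relations between homogeneous elements lie in the ideal generated by
    the 1 - theta E, and that ideal is killed by the map sending a family s to
    the sum of the s_F theta(F - F0) over a linear equivalence class
    ([cox_ideal_class_sum]); so equal elements g1, g2 of degrees E1, E2 satisfy
    g1 = g2 theta(E2 - E1) in K(X) ([presentation_inj]).  Comparing the two
    divisors along D gives n_D + q_D = p_D.

    On the other side, e_D^* is additive on the weights of Xb, which are closed
    under products; so <e_D^*, pi^* chi> + q_D = p_D as well
    ([weight_value_uniq]). *)

(** * Spaces with functions *)

Section SpaceWithFunctions.
Variables (K : closedFieldType) (T : Type) (X : kspace K T).
Hypothesis hX : space_with_functions X.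

Lemma opnT : opn X setT. Proof. by case: hX => -[]. Qed.

Lemma opnI U V : opn X U -> opn X V -> opn X (U `&` V).
Proof. by case: hX => -[_ + _] _; apply. Qed.

Lemma opn_local U :
  (forall x, U x -> exists V, [/\ opn X V, V x & V `<=` U]) -> opn X U.
Proof.
move=> hU; have -> : U = \bigcup_(V in [set V | opn X V /\ V `<=` U]) V.
  apply/seteqP; split=> [x /hU[V [oV Vx VU]]|x [V [_ VU] Vx]]; last exact: VU.
  by exists V.
by case: hX => -[_ _ +] _; apply=> V [].
Qed.

Lemma reg_sub U V f : opn X U -> opn X V -> V `<=` U -> reg X U f -> reg X V f.
Proof. by case: hX => _ [[+ _ _] _]; apply. Qed.

Lemma reg_local U f : opn X U ->
  (forall x, U x -> exists V, [/\ opn X V, V x, V `<=` U & reg X V f]) ->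
  reg X U f.
Proof. by case: hX => _ [[_ + _] _]; apply. Qed.

Lemma eq_reg U f g : opn X U -> reg X U f -> (forall x, U x -> f x = g x) ->
  reg X U g.
Proof. by case: hX => _ [[_ _ +] _]; apply. Qed.

Lemma reg_cst U c : opn X U -> reg X U (cst c).
Proof. by case: hX => _ [_ [+ _ _]]; apply. Qed.

Lemma regD U f g : opn X U -> reg X U f -> reg X U g -> reg X U (f + g).
Proof.
by move=> oU rf rg; case: hX => _ [_ [_ h _]]; case: (h _ _ _ oU rf rg).
Qed.

Lemma regM U f g : opn X U -> reg X U f -> reg X U g -> reg X U (f * g).
Proof.
by move=> oU rf rg; case: hX => _ [_ [_ h _]]; case: (h _ _ _ oU rf rg).
Qed.

Lemma regB U f g : opn X U -> reg X U f -> reg X U g -> reg X U (f - g).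
Proof.
move=> oU rf rg; apply: regD => //.
apply: (@eq_reg _ (cst (-1) * g)) => //; first exact/regM/rg/reg_cst.
by move=> x _; rewrite /= -[RHS]mulN1r.
Qed.

Lemma reg_sum U n (f : 'I_n -> T -> K) : opn X U ->
  (forall i, reg X U (f i)) -> reg X U (fun x => \sum_i f i x).
Proof.
move=> oU rf; rewrite (_ : (fun _ => _) = \sum_i f i).
  elim/big_ind: _ => // [|g h]; [exact: reg_cst | exact: regD].
by apply/funext => x; rewrite fct_sumE.
Qed.

Lemma opn_neq0 U f : opn X U -> reg X U f -> opn X (U `&` [set x | f x != 0]).
Proof. by move=> oU rf; case: hX => _ [_ [_ _ h]]; case: (h _ _ oU rf). Qed.

Lemma regV U f : opn X U -> reg X U f ->
  reg X (U `&` [set x | f x != 0]) (fun x => (f x)^-1).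
Proof. by move=> oU rf; case: hX => _ [_ [_ _ h]]; case: (h _ _ oU rf). Qed.

(** * Rational functions on an irreducible space *)

Section Irreducible.
Hypothesis irrX : irreducible X setT.

Lemma irreducible_meet Z U V : irreducible X Z -> opn X U -> opn X V ->
  U `&` Z !=set0 -> V `&` Z !=set0 -> U `&` V `&` Z !=set0.
Proof.
move=> [_ irrZ] oU oV [x [Ux Zx]] [y [Vy Zy]]; apply: contrapT => h.
have [] := irrZ (~` U) (~` V); rewrite /clsd ?setCK //.
- move=> z Zz /=; apply: contrapT => /not_orP[/contrapT Uz /contrapT Vz].
  by apply: h; exists z.
- by move=> /(_ x Zx).
- by move=> /(_ y Zy).
Qed.

Lemma open_meet U V : opn X U -> opn X V -> U !=set0 -> V !=set0 ->
  U `&` V !=set0.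
Proof.
move=> oU oV [x Ux] [y Vy].
have [||z [Uz _]] := irreducible_meet irrX oU oV; last by exists z.
- by exists x.
- by exists y.
Qed.

Lemma req_refl f : req X f f.
Proof.
by case: irrX => -[x _] _; exists setT; split=> //; [exact: opnT|exists x].
Qed.

Lemma req_sym f g : req X f g -> req X g f.
Proof. by move=> [U [oU U0 h]]; exists U; split=> // x /h ->. Qed.


Lemma req_both f g f' g' : req X f g -> req X f' g' -> exists U,
  [/\ opn X U, U !=set0 & forall x, U x -> f x = g x /\ f' x = g' x].
Proof.
move=> [U [oU U0 h]] [V [oV V0 h']]; exists (U `&` V).
by split=> [||x [/h ? /h' ?]]//; [exact: opnI|exact: open_meet].
Qed.

Lemma req_trans f g h : req X f g -> req X g h -> req X f h.
Proof.
move=> fg /(req_both fg)[U [oU U0 e]]; exists U.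
by split=> // x /e[-> ->].
Qed.

Lemma reqM f g f' g' : req X f g -> req X f' g' -> req X (f * f') (g * g').
Proof.
move=> fg /(req_both fg)[U [oU U0 e]]; exists U; split=> // x /e[e1 e2].
by rewrite [LHS]/(f x * f' x) e1 e2.
Qed.

Lemma reqD f g f' g' : req X f g -> req X f' g' -> req X (f + f') (g + g').
Proof.
move=> fg /(req_both fg)[U [oU U0 e]]; exists U; split=> // x /e[e1 e2].
by rewrite [LHS]/(f x + f' x) e1 e2.
Qed.

Lemma req_sum (I : Type) (r : seq I) (P : pred I) (f g : I -> T -> K) :
  (forall i, P i -> req X (f i) (g i)) ->
  req X (\sum_(i <- r | P i) f i) (\sum_(i <- r | P i) g i).
Proof.
move=> fg; elim: r => [|i r ih]; first by rewrite !big_nil; exact: req_refl.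
by rewrite !big_cons; case: ifP => // /fg fgi; exact: reqD.
Qed.

(** The locus where two regular functions differ is open, so if it is nonempty it
    meets the open set on which they agree. *)
Lemma reg_req_eq V f g : opn X V -> reg X V f -> reg X V g -> req X f g ->
  forall x, V x -> f x = g x.
Proof.
move=> oV rf rg [U [oU U0 fg]] x Vx; apply: contrapT => /eqP fgx.
have := opn_neq0 oV (regB oV rf rg); set W := _ `&` _ => oW.
have [|y [[Vy]]] := open_meet oW oU _ U0; last first.
  move=> /[swap] /fg; rewrite /= -[(_ - _) y]/(f y - g y) => ->.
  by rewrite subrr eqxx.
by exists x; split => //=; rewrite -[(_ - _) x]/(f x - g x) subr_eq0.
Qed.

(** A rational function is nonzero as soon as it is regular and nowhere zero on
    some open set: this is the form in which units of K(X) are used. *)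
Lemma rational_unitP f : rational_unit X f <->
  exists U, [/\ opn X U, U !=set0, reg X U f & forall x, U x -> f x != 0].
Proof.
split=> [[[U [oU U0 rf]] nf]|[U [oU U0 rf nf]]]; last first.
  split; first by exists U.
  move=> [V [oV V0 f0]]; have [x [Ux Vx]] := open_meet oU oV U0 V0.
  by move: (nf x Ux); rewrite f0 // eqxx.
exists (U `&` [set x | f x != 0]); split.
- exact: opn_neq0.
- apply: contrapT => h; apply: nf; exists U; split=> // x Ux.
  by apply: contrapT => /eqP fx; apply: h; exists x.
- by apply: (reg_sub oU (opn_neq0 oU rf) _ rf) => x [].
- by move=> x [].
Qed.

Lemma rational_unitM f g :
  rational_unit X f -> rational_unit X g -> rational_unit X (f * g).
Proof.
move=> /rational_unitP[U [oU U0 rf nf]] /rational_unitP[V [oV V0 rg ng]].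
have oUV := opnI oU oV.
apply/rational_unitP; exists (U `&` V); split=> //; first exact: open_meet.
- by apply: regM => //; [apply: reg_sub rf|apply: reg_sub rg] => // x [].
- by move=> x [/nf fx /ng gx]; rewrite -[(_ * _) x]/(f x * g x) mulf_neq0.
Qed.

Lemma rational_unit_cst (c : K) : c != 0 -> rational_unit X (cst c).
Proof.
move=> c0; apply/rational_unitP; exists setT; split=> //; first exact: opnT.
- by case: irrX => -[x _] _; exists x.
- exact/reg_cst/opnT.
Qed.

Lemma rational_unitV f : rational_unit X f ->
  rational_unit X (fun x => (f x)^-1) /\ req X (f * (fun x => (f x)^-1)) 1.
Proof.
move=> /rational_unitP[U [oU U0 rf nf]]; split.
  apply/rational_unitP; exists U; split=> // [|x /nf]; last by rewrite invr_eq0.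
  by have := regV oU rf; rewrite setIidl.
by exists U; split=> // x /nf fx; rewrite -[(_ * _) x]/(f x * _) divff.
Qed.

Lemma rationalB f g : rational X f -> rational X g -> rational X (f - g).
Proof.
move=> [U [oU U0 rf]] [V [oV V0 rg]].
have oUV := opnI oU oV.
exists (U `&` V); split=> //; first exact: open_meet.
by apply: regB => //; [apply: reg_sub rf|apply: reg_sub rg] => // x [].
Qed.

(** * Valuations along prime divisors *)

Section Valuation.
Variables (D : set T) (v : (T -> K) -> int).
Hypotheses (pD : prime_divisor X D) (hv : divisor_valuation X D v).

Lemma val_req f g : rational_unit X f -> req X f g -> v f = v g.
Proof. by case: hv => + _ _ _; apply. Qed.

Lemma valM f g : rational_unit X f -> rational_unit X g ->
  v (f * g) = v f + v g.
Proof. by case: hv => _ + _ _; apply. Qed.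

Lemma val_ge0 f : rational_unit X f -> 0 <= v f <-> in_local_ring X D f.
Proof. by case: hv => _ _ + _; apply. Qed.

Lemma val1 : v 1 = 0.
Proof.
have u1 : rational_unit X 1 by exact/rational_unit_cst/oner_neq0.
by have := valM u1 u1; rewrite mulr1; lia.
Qed.

Lemma valV f : rational_unit X f -> v (fun x => (f x)^-1) = - v f.
Proof.
move=> uf; have [uV fV] := rational_unitV uf.
have := valM uf uV; rewrite (val_req _ fV); last exact: rational_unitM.
by rewrite val1; lia.
Qed.

Lemma in_local_ring_reg U f : opn X U -> U `&` D !=set0 -> reg X U f ->
  in_local_ring X D f.
Proof. by move=> oU UD rf; exists U, f; split=> //; exact: req_refl. Qed.

(** The valuation is nonnegative on nonzero constants, and on their inverses. *)
Lemma val_cst (c : K) : c != 0 -> v (cst c) = 0.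
Proof.
have ge0 a : a != 0 -> 0 <= v (cst a).
  move=> a0; apply/val_ge0; first exact: rational_unit_cst.
  apply: (in_local_ring_reg opnT); last exact/reg_cst/opnT.
  by case: pD => _ [[x Dx] _] _ _; exists x.
move=> c0; apply/eqP; rewrite eq_le ge0 // andbT.
have := ge0 c^-1; rewrite invr_eq0 => /(_ c0).
rewrite -[cst c^-1]/(fun x => (cst c x)^-1) (valV (rational_unit_cst c0)).
by rewrite oppr_ge0.
Qed.

Lemma in_local_ringB f g : in_local_ring X D f -> in_local_ring X D g ->
  in_local_ring X D (f - g).
Proof.
move=> [U [f' [oU UD rf ff']]] [V [g' [oV VD rg gg']]].
have oUV := opnI oU oV; case: pD => _ irrD _ _.
exists (U `&` V), (f' - g'); split=> //; first exact: (irreducible_meet irrD).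
- by apply: regB => //; [apply: reg_sub rf|apply: reg_sub rg] => // x [].
- have [W [oW W0 e]] := req_both ff' gg'; exists W; split=> // x /e[e1 e2].
  by rewrite -[LHS]/(f x - g x) e1 e2.
Qed.

(** The ultrametric inequality: if v f <= v g, then f - g = f (1 - g / f), and the
    second factor lies in the local ring along D. *)
Lemma valB_ge f g (n : int) : rational_unit X f -> rational_unit X g ->
  rational_unit X (f - g) -> n <= v f -> n <= v g -> n <= v (f - g).
Proof.
(* the case where the first function has the smaller valuation *)
have aux a b : rational_unit X a -> rational_unit X b ->
    rational_unit X (a - b) -> v a <= v b -> v a <= v (a - b).
  move=> ua ub uab ab; have [uV aV] := rational_unitV ua.
  set q := fun x => (a x)^-1 in uV aV.
  have uq := rational_unitM uab uV.
  suff : 0 <= v ((a - b) * q) by rewrite valM // valV //; lia.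
  apply/val_ge0 => //; rewrite mulrBl; apply: in_local_ringB.
    apply/val_ge0; first exact: rational_unitM.
    by rewrite valM // valV // subrr.
  apply/val_ge0; first exact: rational_unitM.
  by rewrite valM // valV // subr_ge0.
move=> uf ug ufg nf ng; have [fg|gf] := leP (v f) (v g).
  exact: le_trans nf (aux _ _ uf ug ufg fg).
have m1 : rational_unit X (cst (-1)).
  by apply: rational_unit_cst; rewrite oppr_eq0 oner_eq0.
have e : g - f = cst (-1) * (f - g).
  by apply/funext => x; rewrite -[RHS]/(-1 * (f x - g x)) mulN1r opprB.
have ugf : rational_unit X (g - f) by rewrite e; exact: rational_unitM.
have := le_trans ng (aux _ _ ug uf ugf (ltW gf)).
by rewrite e valM // val_cst ?add0r // oppr_eq0 oner_eq0.
Qed.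

End Valuation.

End Irreducible.
End SpaceWithFunctions.

(** * Products and slices *)

Section ProductSpace.
Variables (K : closedFieldType) (S T : Type) (Y : kspace K S) (X : kspace K T).
Hypothesis hX : space_with_functions X.

Lemma reg_tensor_slice g (U : set S) (V : set T) n (c : 'I_n -> S -> K)
    (d : 'I_n -> T -> K) : reg_tensor Y X U V c d ->
  reg X V (fun x => tensor c d (g, x)).
Proof.
move=> [oU oV rc rd]; apply: (reg_sum hX) => // i.
exact: (regM hX oV (reg_cst hX (c i g) oV) (rd i)).
Qed.

(** The slice at g of a basic open box is the nonvanishing locus on the second
    factor of a K-linear combination of regular functions. *)
Lemma opn_slice g (W : set (S * T)) :
  opn (prod_space Y X) W -> opn X [set x | W (g, x)].
Proof.
move=> oW; apply: (opn_local hX) => // x /oW[U [V [n [c [d [rcd Ug Vx nz sub]]]]]].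
case: (rcd) => _ oV _ _.
exists (V `&` [set y | tensor c d (g, y) != 0]); split=> //.
- by apply: opn_neq0 => //; exact: reg_tensor_slice rcd.
- by move=> y [Vy nzy]; exact: sub.
Qed.

Lemma reg_slice g (W : set (S * T)) f : opn (prod_space Y X) W ->
  reg (prod_space Y X) W f -> reg X [set x | W (g, x)] (fun x => f (g, x)).
Proof.
move=> oW rf; apply: (reg_local hX); first exact: opn_slice.
move=> x /rf[U [V [n [c [d [m [a [b [rcd rab [Ug Vx] nz sub]]]]]]]]].
have [_ oV _ _] := rcd; have rV := reg_tensor_slice g rcd.
exists (V `&` [set y | tensor c d (g, y) != 0]); have oV' := opn_neq0 hX oV rV.
split=> //; first by move=> y [Vy nzy]; case: (sub (g, y)).
apply: (@eq_reg _ _ _ hX _ ((fun y => tensor a b (g, y)) *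
    (fun y => (tensor c d (g, y))^-1))) => //.
  apply: regM => //; last exact: regV.
  by apply: (reg_sub hX oV oV' _ (reg_tensor_slice g rab)) => y [].
by move=> y [Vy nzy]; case: (sub (g, y)).
Qed.

Hypothesis hY : space_with_functions Y.

(** A product of two finite sums of decomposable tensors is again such a sum, on
    the intersection of the boxes; its terms are indexed by pairs, enumerated by
    an ordinal. *)
Lemma tensorM n (c : 'I_n -> S -> K) (d : 'I_n -> T -> K) n' (c' : 'I_n' -> S -> K)
    (d' : 'I_n' -> T -> K) (U U' : set S) (V V' : set T) :
  reg_tensor Y X U V c d -> reg_tensor Y X U' V' c' d' ->
  exists m (a : 'I_m -> S -> K) (b : 'I_m -> T -> K),
    reg_tensor Y X (U `&` U') (V `&` V') a b /\
    forall z, tensor a b z = tensor c d z * tensor c' d' z.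
Proof.
move=> [oU oV rc rd] [oU' oV' rc' rd'].
have oUU := opnI hY oU oU'; have oVV := opnI hX oV oV'.
pose ix (k : 'I_#|{: 'I_n * 'I_n'}|) : 'I_n * 'I_n' := enum_val k.
exists #|{: 'I_n * 'I_n'}|, (fun k => c (ix k).1 * c' (ix k).2),
  (fun k => d (ix k).1 * d' (ix k).2); split.
  split=> // k; apply: regM => //.
  - by apply: (reg_sub hY oU oUU _ (rc _)) => x [].
  - by apply: (reg_sub hY oU' oUU _ (rc' _)) => x [].
  - by apply: (reg_sub hX oV oVV _ (rd _)) => x [].
  - by apply: (reg_sub hX oV' oVV _ (rd' _)) => x [].
move=> z; rewrite /tensor big_distrlr pair_big /=.
have := @big_enum_val K 0 +%R _ {: 'I_n * 'I_n'} (fun p =>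
  (c p.1 z.1 * d p.1 z.2) * (c' p.2 z.1 * d' p.2 z.2)).
move=> ->; apply: eq_bigr => k _.
by rewrite -[LHS]/((c _ z.1 * c' _ z.1) * (d _ z.2 * d' _ z.2)) mulrACA.
Qed.

Lemma reg_prodM (W : set (S * T)) f g : reg (prod_space Y X) W f ->
  reg (prod_space Y X) W g -> reg (prod_space Y X) W (f * g).
Proof.
move=> rf rg z Wz.
have [U [V [n [c [d [m [a [b [rcd rab [Uz Vz] nz sub]]]]]]]]] := rf z Wz.
have [U' [V' [n' [c' [d' [m' [a' [b' [rcd' rab' [Uz' Vz'] nz' sub']]]]]]]]] :=
  rg z Wz.
have [q [cc [dd [rcc ecc]]]] := tensorM rcd rcd'.
have [q' [aa [bb [raa eaa]]]] := tensorM rab rab'.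
exists (U `&` U'), (V `&` V'), q, cc, dd, q', aa, bb; split=> //.
  by rewrite ecc mulf_neq0.
move=> w [Uw Uw'] [Vw Vw']; rewrite ecc mulf_eq0 negb_or => /andP[nw nw'].
have [Ww fw] := sub w Uw Vw nw; have [_ gw] := sub' w Uw' Vw' nw'.
by rewrite -[(f * g) w]/(f w * g w) fw gw eaa invfM mulrACA.
Qed.

Lemma reg_prod_cst1 (W : set (S * T)) : opn (prod_space Y X) W ->
  reg (prod_space Y X) W (cst 1).
Proof.
move=> oW z /[dup] Wz /oW[U [V [n [c [d [rcd Uz Vz nz sub]]]]]].
exists U, V, n, c, d, n, c, d; split=> // w Uw Vw nw.
by rewrite divff //; split=> //; exact: sub.
Qed.

Lemma opn_prodT : opn (prod_space Y X) setT.
Proof.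
move=> z _; exists setT, setT, 1%N, (fun=> cst 1), (fun=> cst 1).
have t1 (w : S * T) : tensor (fun _ : 'I_1 => cst 1) (fun _ : 'I_1 => cst 1) w = 1 :> K.
  by rewrite /tensor big_ord1 mulr1.
split=> //; last by rewrite t1 oner_neq0.
by split=> [||_|_]; [exact: opnT|exact: opnT|exact/reg_cst/opnT|exact/reg_cst/opnT].
Qed.
End ProductSpace.

(** * Semi-invariant functions *)

Section Action.
Variables (K : closedFieldType) (G : groupType) (sG : kspace K G).
Variables (T : Type) (X : kspace K T) (act : G -> T -> T).
Hypotheses (hX : space_with_functions X) (irrX : irreducible X setT).
Hypothesis hact : alg_action sG X act.

Lemma act_opn g U : opn X U -> opn X (act g @^-1` U).
Proof.
case: hact => _ _ [_ hm] /hm[oW _].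
by have := opn_slice hX g oW; rewrite setTI.
Qed.

Lemma act_reg g U f : opn X U -> reg X U f -> reg X (act g @^-1` U) (f \o act g).
Proof.
case: hact => _ _ [_ hm] /hm[oW rW] /rW; move: oW; rewrite setTI => oW rW'.
exact: (reg_slice hX g oW rW').
Qed.

Lemma semi_invariantM (B : set G) (chi psi : B -> K) f g :
  semi_invariant X act chi f -> semi_invariant X act psi g ->
  semi_invariant X act (chi * psi) (f * g).
Proof.
move=> hf hg b; have [U [oU U0 e]] := req_both hX irrX (hf b) (hg b).
exists U; split=> // x /e[e1 e2].
rewrite -[LHS]/(f (act (val b)^-1%g x) * g (act (val b)^-1%g x)) e1 e2.
by rewrite mulrACA.
Qed.

Lemma semi_invariant1 (B : set G) : semi_invariant X act (1 : B -> K) 1.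
Proof.
move=> b; rewrite (_ : (fun _ => _) = 1); last by [].
rewrite (_ : (fun _ => _) = 1); first exact: (req_refl hX).
by apply/funext => x; rewrite -[LHS]/(1 * 1 : K) mulr1.
Qed.

(** The quotient f / g is invariant, and an invariant function takes the same value
    at any two points of the dense orbit at which it is regular: the equality of
    the two rational functions x |-> (f / g) (b^-1 x) and f / g holds at every
    point where both are regular.  The quotient cannot differ from this value
    anywhere, since the open set where it does would meet the orbit.  To stay with
    regular functions, the invariance is used in the cross-multiplied form
    f (b^-1 x) g x = g (b^-1 x) f x. *)
Lemma semi_invariant_uniq (B : set G) (chi : B -> K) f g : is_subgroup B ->
  (exists x, dense X [set act b x | b in B]) -> (forall b, chi b != 0) ->
  rational_unit X f -> rational_unit X g ->
  semi_invariant X act chi f -> semi_invariant X act chi g ->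
  exists2 c, c != 0 & req X f (cst c * g).
Proof.
move=> [_ BM BV] [x0 dx0] chi0 /(rational_unitP hX irrX)[U [oU U0 rf nf]]
  /(rational_unitP hX irrX)[V [oV V0 rg ng]] sf sg.
set W := U `&` V; have oW : opn X W by exact: (opnI hX).
have W0 : W !=set0 by exact: (open_meet irrX).
have {}rf : reg X W f by apply: (reg_sub hX oU oW _ rf) => x [].
have {}rg : reg X W g by apply: (reg_sub hX oV oW _ rg) => x [].
have [_ [[b0 Bb0 <-] Wy0]] := dx0 W oW W0.
set y0 := act b0 x0 in Wy0; set c := f y0 / g y0.
have c0 : c != 0 by rewrite mulf_neq0 ?invr_eq0 ?(ng y0) ?(nf y0) //; case: Wy0.
exists c => //; apply: contrapT => nfg.
have rcg : reg X W (cst c * g) by apply: (regM hX) => //; exact: (reg_cst hX).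
have oW' := opn_neq0 hX oW (regB hX oW rf rcg).
have [|_ [[b1 Bb1 <-] [Wy1 /=]]] := dx0 _ oW'.
  apply: contrapT => h; apply: nfg; exists W; split=> // x Wx.
  apply: contrapT => /eqP fx; apply: h; exists x; split=> //=.
  by rewrite -[(_ - _) x]/(f x - (cst c * g) x) subr_eq0.
set y1 := act b1 x0 in Wy1 *.
rewrite -[(_ - _) y1]/(f y1 - c * g y1) subr_eq0 => /eqP; apply.
(* b moves the reference point y0 to the new point y1 *)
have Bb : B (b1 * b0^-1)%g by apply: BM => //; exact: BV.
pose b : B := exist (fun x => x \in B) _ (mem_set Bb).
have bV : act (val b)^-1%g y1 = y0.
  case: hact => a1 aM _; rewrite /y1 /y0 -aM /= invgM invgK.
  by rewrite -mulgA mulVg mulg1.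
have fg : req X ((fun x => f (act (val b)^-1%g x)) * g)
                ((fun x => g (act (val b)^-1%g x)) * f).
  have [O [oO O0 e]] := req_both hX irrX (sf b) (sg b).
  exists O; split=> // x /e[e1 e2].
  rewrite -[LHS]/(f (act (val b)^-1%g x) * g x) e1.
  by rewrite -[RHS]/(g (act (val b)^-1%g x) * f x) e2 mulrAC.
have oWb := opnI hX oW (act_opn (val b)^-1%g oW).
have rW h : reg X W h -> reg X (W `&` act (val b)^-1%g @^-1` W) h.
  by move=> rh; apply: (reg_sub hX oW oWb _ rh) => x [].
have rWb h : reg X W h ->
    reg X (W `&` act (val b)^-1%g @^-1` W) (fun x => h (act (val b)^-1%g x)).
  move=> rh; apply: (reg_sub hX (act_opn _ oW) oWb _ (act_reg _ oW rh)).
  by move=> x [].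
have e : f y0 * g y1 = g y0 * f y1.
  rewrite -bV; apply: (reg_req_eq hX irrX oWb (regM hX oWb (rWb _ rf) (rW _ rg))
    (regM hX oWb (rWb _ rg) (rW _ rf)) fg).
  by split=> //=; rewrite bV.
have gy0 : g y0 != 0 by apply: ng; case: Wy0.
by apply: (mulfI gy0); rewrite -e /c [RHS]mulrCA mulrA divfK.
Qed.

End Action.

(** * Weights *)

Section Weights.
Variables (K : closedFieldType) (G' H : groupType).
Variables (sG' : kspace K G') (sH : kspace K H).
Hypotheses (hG' : space_with_functions sG') (hH : space_with_functions sH).
Local Notation sGH := (prod_space sG' sH).
Variables (T : Type) (X : kspace K T) (act : G' * H -> T -> T) (B : set (G' * H)).
Hypotheses (hX : space_with_functions X) (irrX : irreducible X setT).
Let M := weights sGH X act B.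

Lemma weightsM (chi psi : B -> K) : M chi -> M psi -> M (chi * psi).
Proof.
move=> [[hm h0 [p [rp hp]]] [f [uf sf]]] [[hm' h0' [p' [rp' hp']]] [f' [uf' sf']]].
split; last first.
  by exists (f * f'); split; [exact: (rational_unitM hX)|exact: (semi_invariantM hX)].
split.
- move=> a b c e; rewrite -[LHS]/(chi c * psi c) (hm _ _ _ e) (hm' _ _ _ e).
  by rewrite mulrACA.
- by move=> a; rewrite -[(_ * _) a]/(chi a * psi a) mulf_neq0.
- exists (p * p'); split; first exact: reg_prodM.
  by move=> a; rewrite -[LHS]/(chi a * psi a) hp hp'.
Qed.

Lemma weights1 : M (1 : B -> K).
Proof.
split; last first.
  exists 1; split; last exact: semi_invariant1.
  exact: (rational_unit_cst hX irrX (oner_neq0 K)).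
split.
- by move=> a b c _; rewrite -[RHS]/(1 * 1 : K) mulr1.
- by move=> a; exact: oner_neq0.
- by exists (cst 1); split=> //; apply: reg_prod_cst1; exact: opn_prodT.
Qed.

(** A relation rather than an application of nu, so that products of weights need
    not be packed with a proof that they belong to the weight lattice. *)
Definition weight_value (nu : M -> int) (phi : B -> K) (n : int) :=
  exists2 w : M, val w = phi & nu w = n.

Lemma weight_valueM nu phi psi n m : dual_lattice nu ->
  weight_value nu phi n -> weight_value nu psi m ->
  weight_value nu (phi * psi) (n + m).
Proof.
move=> hnu [w <- <-] [w' <- <-].
have Mw := weightsM (set_mem (valP w)) (set_mem (valP w')).
by exists (exist (fun x => x \in M) _ (mem_set Mw)) => //; exact: hnu.
Qed.

Lemma weight_value1 nu : dual_lattice nu -> weight_value nu 1 0.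
Proof.
move=> hnu; exists (exist (fun x => x \in M) _ (mem_set weights1)) => //; set w := exist _ _ _.
(* the trivial weight is its own square *)
have := hnu w w w; rewrite /= mulr1 => /(_ erefl); lia.
Qed.

Lemma weight_value_uniq nu phi n m :
  weight_value nu phi n -> weight_value nu phi m -> n = m.
Proof. by move=> [w <- <-] [w' /val_inj -> <-]. Qed.

End Weights.

(** * Divisors of rational functions *)

Section Divisors.
Variables (K : closedFieldType) (T : Type) (X : kspace K T).
Hypotheses (hX : space_with_functions X) (irrX : irreducible X setT).
Variable nu : set T -> (T -> K) -> int.
Hypothesis hnu : forall D, prime_divisor X D -> divisor_valuation X D (nu D).

Lemma div_req f g : rational_unit X f -> req X f g -> div X nu f = div X nu g.
Proof.
move=> uf fg; apply/funext => D; rewrite /div; case: asboolP => // pD.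
exact: (val_req (hnu pD)).
Qed.

Lemma divM f g : rational_unit X f -> rational_unit X g ->
  div X nu (f * g) = div X nu f + div X nu g.
Proof.
move=> uf ug; apply/funext => D.
rewrite -[RHS]/(div X nu f D + div X nu g D) /div; case: asboolP => // pD.
exact: (valM (hnu pD)).
Qed.

Lemma div_cst (c : K) : c != 0 -> div X nu (cst c) = 0.
Proof.
move=> c0; apply/funext => D; rewrite /div; case: asboolP => // pD.
exact: (val_cst hX irrX pD (hnu pD)).
Qed.

Lemma divV f : rational_unit X f ->
  div X nu (fun x => (f x)^-1) = - div X nu f.
Proof.
move=> uf; apply/funext => D.
rewrite -[RHS]/(- div X nu f D) /div; case: asboolP => // pD.
exact: (valV hX irrX (hnu pD)).
Qed.

Lemma principalD E F : principal X nu E -> principal X nu F ->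
  principal X nu (E + F).
Proof.
move=> [f [uf <-]] [g [ug <-]]; exists (f * g); split; last exact: divM.
exact: (rational_unitM hX irrX).
Qed.

Lemma principalN E : principal X nu E -> principal X nu (- E).
Proof.
move=> [f [uf <-]]; exists (fun x => (f x)^-1); split; last exact: divV.
by case: (rational_unitV hX irrX uf).
Qed.

Lemma principal0 : principal X nu 0.
Proof.
by exists (cst 1); split; [exact: (rational_unit_cst hX irrX (oner_neq0 K))|
  exact/div_cst/oner_neq0].
Qed.

(** * Sections of the sheaves O_X(E) *)

Lemma sections_unit U E f : rational_unit X f ->
  sections X nu U E f <-> forall D, prime_divisor X D -> D `&` U !=set0 ->
    0 <= nu D f + E D.
Proof.
move=> [rf nf]; split=> [[_ /(_ nf)]//|h]; split=> // _; exact: h.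
Qed.

Lemma sections0 U E : sections X nu U E 0.
Proof.
split; last by move=> /(_ (req_refl hX irrX _)).
case: irrX => -[x _] _.
exists setT; split; [exact: opnT|by exists x|exact: (reg_cst hX 0 (opnT hX))].
Qed.

Lemma sectionsB U E f g : sections X nu U E f -> sections X nu U E g ->
  sections X nu U E (f - g).
Proof.
move=> [rf hf] [rg hg]; split=> [|nfg D pD DU]; first exact: (rationalB hX).
have ufg : rational_unit X (f - g) by split=> //; exact: (rationalB hX).
have [f0|nf] := pselect (req X f 0).
  have m1 : rational_unit X (cst (-1)).
    by apply: (rational_unit_cst hX irrX); rewrite oppr_eq0 oner_neq0.
  have e : req X (f - g) (cst (-1) * g).
    have [V [oV V0 e]] := f0; exists V; split=> // x /e fx.
    by rewrite -[LHS]/(f x - g x) fx -[RHS]/(-1 * g x) mulN1r add0r.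
  have ng : ~ req X g 0.
    move=> g0; apply: nfg; apply: (req_trans hX irrX e).
    by rewrite -[0 in X in req _ _ X](mulr0 (cst (-1))); apply: (reqM hX irrX) => //;
      exact: (req_refl hX irrX).
  rewrite (val_req (hnu pD) ufg e) (valM (hnu pD)) //.
  by rewrite (val_cst hX irrX pD (hnu pD)) ?oppr_eq0 ?oner_neq0 // add0r; exact: hg.
have [g0|ng] := pselect (req X g 0).
  have e : req X (f - g) f.
    have [V [oV V0 e]] := g0; exists V; split=> // x /e gx.
    by rewrite -[LHS]/(f x - g x) gx subr0.
  by rewrite (val_req (hnu pD) ufg e); exact: hf.
have := hf nf D pD DU; have := hg ng D pD DU.
rewrite -!lerBlDr !sub0r => ge fe.
by apply: (valB_ge hX irrX pD (hnu pD)).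
Qed.

Lemma sectionsM U E F f g : rational_unit X f -> rational_unit X g ->
  sections X nu U E f -> sections X nu U F g -> sections X nu U (E + F) (f * g).
Proof.
move=> uf ug /(sections_unit _ _ uf) hf /(sections_unit _ _ ug) hg.
apply/sections_unit; first exact: (rational_unitM hX).
move=> D pD DU; rewrite (valM (hnu pD)) // -[(E + F) D]/(E D + F D) addrACA.
by rewrite addr_ge0 ?hf ?hg.
Qed.

Lemma sections_reg U f : opn X U -> reg X U f -> rational_unit X f ->
  sections X nu U 0 f.
Proof.
move=> oU rf uf; apply/sections_unit => // D pD DU; rewrite addr0.
apply/(val_ge0 (hnu pD)) => //; apply: (in_local_ring_reg hX irrX oU) => //.
by rewrite setIC.
Qed.

Lemma sections_effective U E f : rational_unit X f ->
  (forall D, 0 <= (div X nu f + E) D) -> sections X nu U E f.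
Proof.
move=> uf h; apply/sections_unit => // D pD _; have := h D.
by rewrite -[(_ + _) D]/(div X nu f D + E D) /div asboolT.
Qed.

(** * The Cox ring *)

Variable L : set (set T -> int).
Hypothesis hL : divisor_group X nu L.
Variable theta : (set T -> int) -> T -> K.
Hypothesis htheta : principal_splitting X nu L theta.

Lemma divisor_group0 : L 0.
Proof.
case: hL => _ [n [s ->]] _; exists (fun=> 0).
by rewrite big1 // => i _; rewrite mulr0z.
Qed.

Lemma divisor_groupD E F : L E -> L F -> L (E + F).
Proof.
case: hL => _ [n [s ->]] _ [c ->] [d ->]; exists (fun i => c i + d i).
by rewrite -big_split; apply: eq_bigr => i _; rewrite mulrzDr.
Qed.

Lemma divisor_groupN E : L E -> L (- E).
Proof.
case: hL => _ [n [s ->]] _ [c ->]; exists (fun i => - c i).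
by rewrite -sumrN; apply: eq_bigr => i _; rewrite mulrNz.
Qed.

(** The linear equivalence class of F0 in L, a degree of the Cox ring. *)
Let linear_class F0 : set (set T -> int) := [set F | L F /\ principal X nu (F - F0)].

(** Sums over an arbitrary set of a finitely supported family, computed on a list
    that contains the support but need not lie inside the set. *)
Lemma fsum_seq (I : choiceType) (V : nmodType) (A : seq I) (Q : set I) (f : I -> V) :
  uniq A -> (forall i, i \notin A -> f i = 0) ->
  \sum_(i \in Q) f i = \sum_(i <- A | i \in Q) f i.
Proof.
move=> uA fA; rewrite [RHS]bigfs ?set_mem_set//= => i _.
exact: fA.
Qed.

(** theta 0 is an idempotent unit. *)
Lemma theta0 : req X (theta 0) 1.
Proof.
have [h1 h2] := htheta; have L0 := divisor_group0.
have [u0 _] := h1 0 L0 principal0.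
have := h2 0 0 L0 principal0 L0 principal0; rewrite addr0 => e.
have [_ tV] := rational_unitV hX irrX u0.
set t' := fun x => _ in tV.
apply: req_trans (tV) => //.
rewrite -[X in req _ X _]mulr1.
have e2 := reqM hX irrX e (req_refl hX irrX t').
have e3 := reqM hX irrX (req_refl hX irrX (theta 0)) tV.
apply: (req_trans hX irrX (req_sym e3)); rewrite mulrA.
exact: (req_sym e2).
Qed.

(** Multiplying the degree F component by theta (F - F0) moves it to degree F0.
    On a generator a (1 - theta E) of the ideal, of components
    a F - a (F + E) theta E, multiplicativity of theta turns the second term into
    a (F + E) theta (F + E - F0), so the two sums over the class of F0 differ by
    the reindexing F |-> F + E and cancel. *)
Lemma cox_ideal_class_sum U (s : (set T -> int) -> T -> K) F0 : L F0 ->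
  finite_set [set F | s F <> 0] -> cox_ideal X nu L theta U s ->
  req X (\sum_(F \in linear_class F0) s F * theta (F - F0)) 0.
Proof.
move=> LF0 fins [n [a [E [ha hE hs]]]].
pose w F := theta (F - F0).
(* all degrees that occur in s, in the a i, or in their translates by - E i *)
have fina : finite_set ([set F | s F <> 0] `|`
  \bigcup_(i in [set: 'I_n]) ([set F | a i F <> 0] `|`
     (fun F => F - E i) @` [set F | a i F <> 0])).
  rewrite finite_setU; split=> //; apply: bigcup_finite; first exact: finite_finset.
  move=> i _; case: (ha i) => fai _ _.
  by rewrite finite_setU; split=> //; exact: finite_image.
have /finite_seqP[A0 hA0] := fina.
pose A := undup A0.
have inA F : F \notin A -> [/\ s F = 0, forall i, a i F = 0 &
    forall i, a i (F + E i) = 0].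
  rewrite mem_undup => /negP nA.
  have {}nA : ~ [set` A0] F by [].
  move: nA; rewrite -hA0 => /not_orP[/contrapT ? nF].
  split=> // i; apply: contrapT => h; apply: nF; exists i => //; first by left.
  by right; exists (F + E i) => //; rewrite addrK.
have uA : uniq A by exact: undup_uniq.
rewrite (fsum_seq _ uA); last by move=> F /inA[-> _ _]; rewrite mul0r.
pose a1 i F := a i F * w F.
have classE i F : linear_class F0 F <-> linear_class F0 (F + E i).
  have [LE pE] := hE i; rewrite /linear_class /=; split=> -[LF pF].
    by rewrite addrAC; split; [exact: divisor_groupD|exact: principalD].
  split; first by rewrite -(addrK (E i) F); apply/divisor_groupD/divisor_groupN.
  have -> : F - F0 = F + E i - F0 - E i by rewrite addrAC addrK.
  by apply: principalD => //; exact: principalN.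
apply: (@req_trans _ _ _ hX irrX _ (\sum_(F <- A | F \in linear_class F0)
    \sum_i (a1 i F - a1 i (F + E i)))).
  apply: (req_sum hX irrX) => F; rewrite inE => -[LF pF].
  apply: (req_trans hX irrX (reqM hX irrX (hs F) (req_refl hX irrX _))).
  rewrite big_distrl /=; apply: (req_sum hX irrX) => i _.
  have [LE pE] := hE i.
  rewrite mulrBl; apply: (reqD hX irrX); first exact: (req_refl hX irrX).
  have [_ h2] := htheta.
  have LFF : L (F - F0) by apply/divisor_groupD/divisor_groupN.
  have := h2 _ _ LE pE LFF pF.
  rewrite (_ : E i + (F - F0) = F + E i - F0); last by rewrite addrCA addrA.
  move=> e; rewrite /a1 -mulrA -!mulNr.
  apply: (reqM hX irrX); [exact: (req_refl hX irrX)|exact: (req_sym e)].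
rewrite exchange_big /= big1; first exact: (req_refl hX irrX).
move=> i _.
rewrite big_split /= sumrN; apply/eqP; rewrite subr_eq0; apply/eqP.
rewrite -(fsum_seq (linear_class F0) (f := a1 i) uA); last first.
  by move=> F /inA[_ h _]; rewrite /a1 h mul0r.
rewrite -(fsum_seq (linear_class F0) (f := fun F => a1 i (F + E i)) uA); last first.
  by move=> F /inA[_ _ h]; rewrite /a1 h mul0r.
apply: reindex_fsbig; split.
- by move=> F /classE.
- by move=> F G _ _ /addIr.
- move=> F cF; exists (F - E i); last exact: subrK.
  by apply/(classE i); rewrite subrK.
Qed.

Lemma fsum_delta2 (I : choiceType) (V : zmodType) (Q : set I) i j (a b : V) :
  \sum_(k \in Q) ((if k == i then a else 0) - (if k == j then b else 0)) =
  (if i \in Q then a else 0) - (if j \in Q then b else 0).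
Proof.
have delta (A : seq I) l (c : V) : uniq A -> l \in A ->
    \sum_(k <- A | k \in Q) (if k == l then c else 0) = if l \in Q then c else 0.
  move=> uA lA; rewrite big_mkcond (bigD1_seq l) //= eqxx big1 ?addr0 // => k.
  by move=> /negPf ->; case: ifP.
rewrite (fsum_seq _ (undup_uniq [:: i; j])); last first.
  move=> k; rewrite mem_undup !inE negb_or => /andP[/negPf -> /negPf ->].
  by rewrite subrr.
by rewrite sumrB !delta ?undup_uniq // mem_undup !inE eqxx ?orbT.
Qed.

Variables (Tb : Type) (Xb : kspace K Tb).
Variable Phi : (set T -> int) -> (T -> K) -> (Tb -> K).

(** Equal homogeneous elements of the Cox ring, coming from sections of degrees E1
    and E2, have linearly equivalent degrees and differ by the corresponding
    rational function.  The family with g1 in degree E1 and - g2 in degree E2 lies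
    in the kernel of the presentation, so its sum over the class of E1 vanishes;
    this sum is g1 alone, hence nonzero, unless E2 is in the class as well. *)
Lemma presentation_inj U V E1 E2 g1 g2 :
  cox_presentation X nu L theta Xb Phi U V -> L E1 -> L E2 ->
  sections X nu U E1 g1 -> sections X nu U E2 g2 -> ~ req X g1 0 ->
  (forall x, V x -> Phi E1 g1 x = Phi E2 g2 x) ->
  exists t, [/\ rational_unit X t, div X nu t = E2 - E1 & req X g1 (g2 * t)].
Proof.
move=> [[_ _ lin] [_ [_ ker]]] LE1 LE2 s1 s2 ng eqV.
have phiB E f g x : L E -> sections X nu U E f -> sections X nu U E g -> V x ->
    Phi E (f - g) x = Phi E f x - Phi E g x.
  move=> LE sf sg Vx; rewrite addrC -[- g]mulN1r.
  by rewrite (lin E g f (-1)) // mulN1r addrC.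
have phi0 E x : L E -> V x -> Phi E 0 x = 0.
  move=> LE Vx; have s0 := sections0 U E.
  by rewrite -[X in Phi E X]subr0 phiB // subrr.
(* written as a difference so that E1 = E2 is not a separate case *)
pose s F : T -> K := (if F == E1 then g1 else 0) - (if F == E2 then g2 else 0).
have fins : finite_set [set F | s F <> 0].
  apply: (@sub_finite_set _ _ [set` [:: E1; E2]]); last exact: finite_seq.
  move=> F /= sF; rewrite !inE; apply: contrapT => /negP.
  rewrite negb_or => /andP[/negPf n1 /negPf n2].
  by apply: sF; rewrite /s n1 n2 subrr.
have sects F : sections X nu U F (s F).
  by apply: sectionsB; case: eqP => [->|_] //; exact: sections0.
have gs : graded_sections X nu L U s.
  split=> // F; rewrite /s; case: eqP => [-> _|_] //; case: eqP => [-> _|_] //.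
  by rewrite subrr.
have phis x : V x -> \sum_(E \in L) Phi E (s E) x = 0.
  move=> Vx; rewrite (eq_fsbigr (fun E => (if E == E1 then Phi E1 g1 x else 0) -
      (if E == E2 then Phi E2 g2 x else 0))).
    by rewrite fsum_delta2 !mem_set // eqV // subrr.
  move=> E; rewrite inE => LE; rewrite /s phiB //;
    try by case: eqP => [->|_] //; exact: sections0.
  by congr (_ - _); case: eqP => [->|_] //; exact: phi0.
have := cox_ideal_class_sum LE1 fins (proj1 (ker s gs) phis).
rewrite (eq_fsbigr (fun E => (if E == E1 then g1 * theta (E1 - E1) else 0) -
      (if E == E2 then g2 * theta (E2 - E1) else 0))); last first.
  move=> F _; rewrite /s mulrBl; congr (_ - _).
    by case: eqP => [->|_] //; rewrite mul0r.
  by case: eqP => [->|_] //; rewrite mul0r.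
rewrite fsum_delta2 mem_set; last first.
  by rewrite /linear_class /= subrr; split=> //; exact: principal0.
rewrite subrr.
have e1 : req X (g1 * theta 0) g1.
  by rewrite -[X in req _ _ X]mulr1; apply: (reqM hX irrX (req_refl hX irrX _) theta0).
case: ifPn => [|_]; last first.
  by rewrite subr0 => /(req_trans hX irrX (req_sym e1)).
rewrite inE => -[_ pE] h.
have LEE : L (E2 - E1) by apply: divisor_groupD => //; exact: divisor_groupN.
have [/(_ _ LEE pE)[ut dt] _] := htheta.
exists (theta (E2 - E1)); split=> //.
apply: (req_trans hX irrX (req_sym e1)).
rewrite -[X in req _ _ X]add0r -[X in req _ X _](subrK (g2 * theta (E2 - E1))).
exact: (reqD hX irrX h (req_refl hX irrX _)).
Qed.

(** k restricts on V to a homogeneous element of the Cox ring over U with divisor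
    Z: a section g of O_X(E) has divisor div g + E, which is the same for the
    sections of other degrees that represent the same element. *)
Definition section_divisor U V (k : Tb -> K) (Z : set T -> int) := exists E g,
  [/\ L E, rational_unit X g, sections X nu U E g, div X nu g + E = Z &
      forall x, V x -> k x = Phi E g x].

Section Presentation.
Variables (U : set T) (V : set Tb).
Hypothesis hUV : cox_presentation X nu L theta Xb Phi U V.

(** From g1 = g2 t and div t = E2 - E1 one gets div g1 + E1 = div g2 + E2. *)
Lemma section_divisor_uniq k Z k' Z' :
  section_divisor U V k Z -> section_divisor U V k' Z' ->
  (forall x, V x -> k x = k' x) -> Z = Z'.
Proof.
move=> [E [g [LE ug sg <- kE]]] [E' [g' [LE' ug' sg' <- kE']]] kk'.
have [|x Vx|t [ut dt gt]] := presentation_inj hUV LE LE' sg sg'.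
- by case: ug.
- by rewrite -kE // kk' // kE'.
rewrite (div_req ug gt) (divM ug' ut) dt -addrA; congr (_ + _).
by rewrite subrK.
Qed.

(** A nonzero section of some O_X(E) is nonzero in the Cox ring. *)
Lemma section_divisor_neq0 k Z : section_divisor U V k Z ->
  exists2 x, V x & k x != 0.
Proof.
move=> [E [g [LE ug sg _ kE]]]; apply: contrapT => h; case: (ug) => _ [].
have [||t [_ _]] := presentation_inj hUV LE LE sg (sections0 U E).
- by case: ug.
- move=> x Vx; case: hUV => -[_ _ lin] _.
  have k0 : k x = 0 by apply: contrapT => /eqP kx; apply: h; exists x.
  rewrite -kE // k0 -[X in Phi E X](addr0 0) -[X in X + 0](mulr0 (cst (-1))).
  by rewrite lin ?mulN1r ?addNr //; exact: sections0.
by rewrite mul0r.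
Qed.

Lemma section_divisorM k Z k' Z' :
  section_divisor U V k Z -> section_divisor U V k' Z' ->
  section_divisor U V (k * k') (Z + Z').
Proof.
move=> [E [g [LE ug sg <- kE]]] [E' [g' [LE' ug' sg' <- kE']]].
exists (E + E'), (g * g'); split.
- exact: divisor_groupD.
- exact: (rational_unitM hX irrX).
- exact: sectionsM.
- by rewrite divM // addrACA.
- case: hUV => _ [[mul _] _] x Vx.
  by rewrite mul // -kE // -kE'.
Qed.

Lemma section_divisor1 : section_divisor U V 1 0.
Proof.
have u1 : rational_unit X (cst 1).
  exact: (rational_unit_cst hX irrX (oner_neq0 K)).
have d1 : div X nu (cst 1) = 0 by exact/div_cst/oner_neq0.
exists 0, (cst 1); split=> //; first exact: divisor_group0.
- by apply: sections_effective => // D; rewrite d1 addr0.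
- by rewrite d1 addr0.
- by case: hUV => _ [[_ one] _] x /one.
Qed.

Lemma section_divisor_rational_unit k Z :
  space_with_functions Xb -> irreducible Xb setT -> opn Xb V -> reg Xb V k ->
  section_divisor U V k Z -> rational_unit Xb k.
Proof.
move=> hXb irrXb oV rk kZ; apply/(rational_unitP hXb irrXb).
exists (V `&` [set x | k x != 0]); split.
- exact: opn_neq0.
- by have [x Vx kx] := section_divisor_neq0 kZ; exists x.
- by apply: (reg_sub hXb oV (opn_neq0 hXb oV rk) _ rk) => x [].
- by move=> x [].
Qed.

Lemma canonical_section_divisor D s : canonical_section X nu L Phi D s ->
  section_divisor U V s (fun D' => (D' == D)%:Z).
Proof.
move=> [E [h [LE uh dh ->]]]; exists E, h; split=> //; last by rewrite dh subrK.
by apply: sections_effective => // D'; rewrite dh subrK; case: eqP.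
Qed.

Lemma pullback_divisor f (pi : Tb -> T) : opn X U -> reg X U f ->
  rational_unit X f -> (forall x, V x -> Phi 0 f x = f (pi x)) ->
  section_divisor U V (f \o pi) (div X nu f).
Proof.
move=> oU rf uf fpi; exists 0, f; split=> //; first exact: divisor_group0.
- exact: sections_reg.
- exact: addr0.
- by move=> x /fpi.
Qed.

End Presentation.
End Divisors.

(** * Monomials *)

(** A relation that turns products into sums is compatible with monomials; it
    serves for divisors of sections, for values of linear forms on weights and,
    with a trivial second component, for regularity. *)
Lemma monomial_ind (A : pzSemiRingType) (Z : nmodType) (R : A -> Z -> Prop)
    (I : Type) (r : seq I) (k : I -> A) (z : I -> Z) (n : I -> nat) :
  R 1 0 -> (forall a x b y, R a x -> R b y -> R (a * b) (x + y)) ->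
  (forall i, R (k i) (z i)) ->
  R (\prod_(i <- r) k i ^+ n i) (\sum_(i <- r) z i *+ n i).
Proof.
move=> R1 RM Rk; have RX i m : R (k i ^+ m) (z i *+ m).
  by elim: m => // m ih; rewrite exprS mulrS; exact: RM.
by elim: r => [|i r ih]; rewrite ?big_nil // !big_cons; exact: RM.
Qed.

Lemma semi_invariant_monomial (K : closedFieldType) (G : groupType) (T : Type)
    (X : kspace K T) (act : G -> T -> T) (B : set G) (I : Type) (r : seq I)
    (chi : I -> B -> K) (f : I -> T -> K) (n : I -> nat) :
  space_with_functions X -> irreducible X setT ->
  (forall i, semi_invariant X act (chi i) (f i)) ->
  semi_invariant X act (\prod_(i <- r) chi i ^+ n i) (\prod_(i <- r) f i ^+ n i).
Proof.
move=> hX irrX sf; have s1 := semi_invariant1 act hX irrX (B := B).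
have sX i m : semi_invariant X act (chi i ^+ m) (f i ^+ m).
  by elim: m => // m ih; rewrite !exprS; exact: semi_invariantM.
elim: r => [|i r ih]; first by rewrite !big_nil.
by rewrite !big_cons; exact: semi_invariantM.
Qed.

(** Moving the negative exponents to the other side leaves natural exponents, for
    which only closure under products is needed. *)
Lemma lattice_basis_monomial (K : closedFieldType) (B : Type) (M : set (B -> K))
    (I : choiceType) (e : I -> M) : (forall i b, val (e i) b != 0) ->
  lattice_basis e -> forall chi : M, exists r (p q : I -> nat),
  val chi * \prod_(i <- r) val (e i) ^+ q i = \prod_(i <- r) val (e i) ^+ p i.
Proof.
move=> e0 he chi; have [c [[finc hc] _]] := he chi.
have /finite_seqP[r0 hr] := finc.
have [p [q cpq]] : exists p q : I -> nat, forall i, c i = (p i)%:Z - (q i)%:Z.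
  exists (fun i => if (0 <= c i) then `|c i|%N else 0%N).
  exists (fun i => if (0 <= c i) then 0%N else `|c i|%N).
  by move=> i; case: ifP; lia.
exists (undup r0), p, q; apply/funext => b.
rewrite -[LHS]/(val chi b * (\prod_(i <- undup r0) val (e i) ^+ q i) b) hc.
rewrite !fct_prodE (fsbigE (undup r0)) ?undup_uniq //; last first.
  move=> i _; rewrite mem_undup => /negP ni.
  have -> : c i = 0; last by rewrite expr0z.
  apply/eqP; apply: contrapT => /negP ci; apply: ni.
  by have : [set` r0] i by rewrite -hr.
rewrite (eq_bigl xpredT); last by move=> i; rewrite mem_set.
rewrite -big_split; apply: eq_bigr => i _ /=.
rewrite !exprfctE cpq (expfzDr _ _ (e0 i b)) -invr_expz -!exprnP divfK //.
by rewrite expf_neq0.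
Qed.

(** * The theorem *)

Theorem proposition2p3 (K : closedFieldType) (charK : [pchar K] =i pred0)
  (* G, its Borel subgroup B and maximal torus T *)
  (G : groupType) (sG : kspace K G) (B T : set G)
  (hG : connected_reductive sG)
  (hB : borel sG setT B) (hT : maximal_torus sG setT T) (hTB : T `<=` B)
  (* the spherical variety X, and the valuations of its prime divisors *)
  (X : Type) (sX : kspace K X) (act : G -> X -> X)
  (hX : spherical sG sX act B)
  (hunits : forall f, reg sX setT f -> (forall x, f x != 0) ->
     exists c, forall x, f x = c)
  (nu : set X -> (X -> K) -> int)
  (hnu : forall D, prime_divisor sX D -> divisor_valuation sX D (nu D))
  (* the Cox ring R(X), identified with the coordinate ring of Xb = Spec R(X) *)
  (L : set (set X -> int)) (hL : divisor_group sX nu L)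
  (theta : (set X -> int) -> X -> K) (htheta : principal_splitting sX nu L theta)
  (Xb : Type) (sXb : kspace K Xb) (Phi : (set X -> int) -> (X -> K) -> Xb -> K)
  (hXb : total_coordinate_space sX nu L theta sXb Phi)
  (* H = Spec K[Cl(X)], acting on Xb, and the good quotient pi : Xh -> X *)
  (H : groupType) (sH : kspace K H) (ev : (set X -> int) -> H -> K)
  (hH : cox_torus sX nu L sH ev)
  (actH : H -> Xb -> Xb) (hactH : alg_action sH sXb actH)
  (hgrad : grading_action sX nu L Phi ev actH)
  (Xh : set Xb) (pi : Xb -> X)
  (hpi : characteristic_space sX nu L theta sXb Phi actH Xh pi)
  (* the covering eps : G' -> G and the lifted action *)
  (G' : groupType) (sG' : kspace K G') (hG' : connected_reductive sG')
  (eps : G' -> G) (heps : finite_epimorphism sG' sG eps)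
  (act' : G' -> Xb -> Xb) (hact' : alg_action sG' sXb act')
  (hXh : forall g x, Xh x -> Xh (act' g x))
  (hcomm : forall g t x, act' g (actH t x) = actH t (act' g x))
  (hequiv : forall g x, Xh x -> pi (act' g x) = act (eps g) (pi x)) :
  (* Gb is the product of G' and the identity component of H *)
  let sGH := prod_space sG' sH in
  let Gb : set (G' * H) := [set z | identity_component sH z.2] in
  let actb := fun (z : G' * H) x => act' z.1 (actH z.2 x) in
  forall (Bb Tb : set (G' * H))
  (hBb : borel sGH Gb Bb) (hTb : maximal_torus sGH Gb Tb) (hTBb : Tb `<=` Bb)
  (hBbB : [set eps z.1 | z in Bb] = B) (hTbT : [set eps z.1 | z in Tb] = T)
  (hsph : spherical sGH sXb actb Bb),
  let M := weights sG sX act B in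
  let Mb := weights sGH sXb actb Bb in
  let Delta := invariant_primes sX act B in
  forall
  (* the rational functions f_chi *)
  (f : M -> X -> K)
  (hf : forall chi : M, rational_unit sX (f chi) /\
     semi_invariant sX act (val chi) (f chi))
  (* the canonical sections 1_D, of weights e_D *)
  (oneD : Delta -> Xb -> K)
  (honeD : forall D : Delta, canonical_section sX nu L Phi (val D) (oneD D))
  (e : Delta -> Mb)
  (he : forall D : Delta, semi_invariant sXb actb (val (e D)) (oneD D))
  (hbasis : lattice_basis e)
  (estar : Delta -> Mb -> int) (hestar : dual_basis e estar)
  (* pi^* chi is the weight of the pullback of f_chi *)
  (pi_up : M -> Mb)
  (hpi_up : forall chi : M,
     semi_invariant sXb actb (val (pi_up chi)) (f chi \o pi)),
  forall D : Delta, dual_map pi_up (estar D) = rho nu f (val D).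
Proof.
move=> sGH Gb actb Bb Tb hBb hTb hTBb hBbB hTbT hsph M Mb Delta f hf oneD honeD
  e he hbasis estar hestar pi_up hpi_up D.
have [[[wfX _ _] irrX _ _ _] [[wfXb _ _] irrXb _ hactb denseb]] := (hX, hsph).
have wfG' : space_with_functions sG' by case: hG' => -[[]].
have wfH : space_with_functions sH by case: hH => -[[]].
have [_ presX] := hXb.
have [_ _ [_ [_ hpiV] _ _ _] presU pullbackU] := hpi.
apply/funext => chi; rewrite /dual_map /rho /=.
have Mb0 (w : Mb) b : val w b != 0.
  by have /set_mem[[_ +_] _] := valP w; apply.
have [r [p [q epq]]] := lattice_basis_monomial (fun i => Mb0 (e i)) hbasis (pi_up chi).
have [estarD estar_e] := hestar D.
have val_monomial n : weight_value (estar D) (\prod_(i <- r) val (e i) ^+ n i)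
    (\sum_(i <- r) (D == i)%:Z *+ n i).
  apply: (monomial_ind (R := weight_value (estar D))).
  - exact: weight_value1.
  - by move=> *; exact: weight_valueM.
  - by move=> i; exists (e i).
have val_eq : estar D (pi_up chi) + \sum_(i <- r) (D == i)%:Z *+ q i =
    \sum_(i <- r) (D == i)%:Z *+ p i.
  apply: (weight_value_uniq (nu := estar D)) (val_monomial p); rewrite -epq.
  by apply: weight_valueM => //; exists (pi_up chi).
have [ufchi sfchi] := hf chi.
have [U [oU U0 rf nf]] := (rational_unitP wfX irrX (f chi)).1 ufchi.
set V := Xh `&` pi @^-1` U.
have pres : cox_presentation sX nu L theta sXb Phi U V := presU U oU U0.
have [oV rV] := hpiV U oU.
have onediv (i : Delta) : section_divisor sX nu L Phi U V (oneD i)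
    (fun D' => (D' == val i)%:Z).
  exact: canonical_section_divisor (honeD i).
have onereg (i : Delta) : reg sXb V (oneD i).
  have [E [h [LE uh dh ->]]] := honeD i.
  have [[regPhi _ _] _] := presX.
  apply: (reg_sub wfXb (opnT wfXb) oV) => //; apply: regPhi => //.
  by apply: sections_effective => // D'; rewrite dh subrK; case: eqP.
have regmon n : reg sXb V (\prod_(i <- r) oneD i ^+ n i).
  apply: (@monomial_ind _ int (fun k _ => reg sXb V k) _ r oneD (fun=> 0) n) => //.
    exact: (reg_cst wfXb 1 oV).
  by move=> *; exact: (regM wfXb).
have divmon n : section_divisor sX nu L Phi U V (\prod_(i <- r) oneD i ^+ n i)
    (\sum_(i <- r) (fun D' => (D' == val i)%:Z) *+ n i).
  apply: (monomial_ind (R := section_divisor sX nu L Phi U V)) => //.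
  - exact: (section_divisor1 wfX irrX hnu hL pres).
  - by move=> *; exact: (section_divisorM wfX irrX hnu hL pres).
(* pi is a morphism only on Xh, so regularity of F is asserted on V *)
pose F := (f chi \o pi) * \prod_(i <- r) oneD i ^+ q i.
have regF : reg sXb V F by apply: (regM wfXb) => //; exact: rV.
have divF : section_divisor sX nu L Phi U V F
   (div sX nu (f chi) + \sum_(i <- r) (fun D' => (D' == val i)%:Z) *+ q i).
  apply: (section_divisorM wfX irrX hnu hL pres) => //.
  apply: (pullback_divisor wfX irrX hnu hL) => //.
  by move=> x [Xhx Ux]; exact: (pullbackU U).
have unitV := section_divisor_rational_unit wfX irrX hnu hL htheta pres wfXb irrXb oV.
have [[[Bbg _] _ _ _] _] := hBb.
pose phi : Bb -> K := \prod_(i <- r) val (e i) ^+ p i.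
have phi0 b : phi b != 0.
  by rewrite /phi; have [w <- _] := val_monomial p; exact: Mb0.
have semiG : semi_invariant sXb actb phi (\prod_(i <- r) oneD i ^+ p i).
  exact: semi_invariant_monomial.
have semiF : semi_invariant sXb actb phi F.
  rewrite /phi -epq; apply: (semi_invariantM wfXb irrXb) => //.
  exact: semi_invariant_monomial.
have [c c0 FG] := semi_invariant_uniq wfXb irrXb hactb Bbg denseb phi0
   (unitV _ _ regF divF) (unitV _ _ (regmon p) (divmon p)) semiF semiG.
(* a constant is the pullback of a constant, hence has divisor 0 *)
have divc : section_divisor sX nu L Phi U V (cst c) 0.
  rewrite -(div_cst wfX irrX hnu c0).
  apply: (pullback_divisor wfX irrX hnu hL (f := cst c) (pi := pi) oU).
  - exact: (reg_cst wfX).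
  - exact: (rational_unit_cst wfX irrX).
  - by move=> x [Xhx Ux]; apply: (pullbackU U) => //; exact: (reg_cst wfX).
have regcG : reg sXb V (cst c * \prod_(i <- r) oneD i ^+ p i).
  by apply: (regM wfXb) => //; exact: (reg_cst wfXb).
have divFG := section_divisor_uniq wfX irrX hnu hL htheta pres divF
  (section_divisorM wfX irrX hnu hL pres divc (divmon p))
  (reg_req_eq wfXb irrXb oV regF regcG FG).
have pD : prime_divisor sX (val D) by have /set_mem[] := valP D.
have evalD n : (\sum_(i <- r) (fun D' => (D' == val i)%:Z) *+ n i) (val D) =
    \sum_(i <- r) (D == i)%:Z *+ n i.
  rewrite fct_sumE; apply: eq_bigr => i _; rewrite natmulfctE.
  by have -> : (val D == val i) = (D == i) by apply/eqP/eqP => [/val_inj|->].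
have := congr1 (fun Z => Z (val D)) divFG; rewrite add0r evalD.
rewrite -[LHS]/(div sX nu (f chi) (val D) +
  (\sum_(i <- r) (fun D' => (D' == val i)%:Z) *+ q i) (val D)) evalD.
by rewrite /div asboolT // -val_eq => /addIr.
Qed.
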